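(* Let $m\ge1$ and $n\ge1$ be integers. For $0\le s\le m-1$ define $$H_{m,s}(q)=\frac{\prod_{j=0}^{s}(1+q^{2m-2j-1})}{(1+q)^{s}(1-q)^{2s}}\sum_{k=0}^{s}\frac{(-1)^{s-k}}{1+q^{2m-2k-1}}\binom{2m-1}{k}\sum_{i=0}^{s-k}\binom{m-s+i-1}{i}\left[\binom{m-k-i-1}{s-k-i}q^{2s-2k-2i}+\binom{m-k-i-2}{s-k-i-1}q^{2s-2k-2i-1}\right].$$ Then each $H_{m,s}(q)$ is a polynomial in $\mathbb{Z}[q]$, and $$T_{2m-1,n}(q)=(-1)^{m+n}H_{m,m-1}(q^{1/2})\frac{q^{mn-\frac n2}}{(1+q^{1/2})^{m}\prod_{i=0}^{m-1}(1+q^{m-i-\frac12})}+\frac{1-q^{n+\frac12}}{1-q^{1/2}}\sum_{k=0}^{m-1}(-1)^k\frac{H_{m,k}(q^{1/2})(1-q^n)^{m-k-1}(1-q^{n+1})^{m-k-1}q^{kn}}{(1-q)^{2m-2k-2}(1+q^{1/2})^{k+1}\prod_{i=0}^{k}(1+q^{m-i-\frac12})}.$$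
   Context: $q$ is an indeterminate and $q^{1/2}$ a fixed formal square root of $q$; identities are identities of rational functions in $q^{1/2}$. For integers $m,n\ge1$, $$T_{m,n}(q)=\sum_{k=1}^{n}(-1)^{n-k}\left(\frac{1-q^k}{1-q}\right)^{m}q^{\frac m2(n-k)}.$$ Binomial coefficients $\binom{a}{b}$ with integers $a,b$ are taken to be $0$ when $b<0$ or when $0\le a<b$. *)

(* Defs.v *)
(* Rational functions in t = q^{1/2} are elements of the
   fraction field {fraction {poly int}}; the indeterminate is [tq]. *)
From mathcomp Require Import all_boot all_order all_algebra.
Set Implicit Arguments. Unset Strict Implicit. Unset Printing Implicit Defensive.
Import Order.TTheory GRing.Theory Num.Theory.
Local Open Scope ring_scope.

Definition RF := {fraction {poly int}}.

(* The indeterminate (used as t = q^{1/2}). *)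
Definition tq : RF := FracField.tofrac 'X.

Definition polyF (p : {poly int}) : RF := FracField.tofrac p.

(* Integer binomial coefficient: 0 if b < 0; 'C(a,b) if a >= 0 (so 0 when
   0 <= a < b); for a < 0 <= b the usual extension (-1)^b C(b-a-1,b)
   (never used in the statement). *)
Definition binz (a b : int) : int :=
  match b with
  | Negz _ => 0
  | Posz b' =>
      match a with
      | Posz a' => ('C(a', b'))%:Z
      | Negz a' => (-1) ^+ b' * ('C(b' + a', b'))%:Z
      end
  end.

Definition H (m s : nat) (x : RF) : RF :=
  (\prod_(0 <= j < s.+1) (1 + x ^ (2 * m%:Z - 2 * j%:Z - 1)))
  / ((1 + x) ^+ s * (1 - x) ^+ (2 * s))
  * \sum_(0 <= k < s.+1)
      ((-1) ^+ (s - k) / (1 + x ^ (2 * m%:Z - 2 * k%:Z - 1))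
       * (binz (2 * m%:Z - 1) k%:Z)%:~R
       * \sum_(0 <= i < (s - k).+1)
           ((binz (m%:Z - s%:Z + i%:Z - 1) i%:Z)%:~R
            * ((binz (m%:Z - k%:Z - i%:Z - 1) (s%:Z - k%:Z - i%:Z))%:~R
                 * x ^ (2 * s%:Z - 2 * k%:Z - 2 * i%:Z)
               + (binz (m%:Z - k%:Z - i%:Z - 2) (s%:Z - k%:Z - i%:Z - 1))%:~R
                 * x ^ (2 * s%:Z - 2 * k%:Z - 2 * i%:Z - 1)))).

(* T_{m,n}(q) written in terms of t = q^{1/2}: q^k = t^(2k),
   q^{(m/2)(n-k)} = t^(m(n-k)). *)
Definition T (m n : nat) (t : RF) : RF :=
  \sum_(1 <= k < n.+1)
    (-1) ^+ (n - k) * ((1 - t ^+ (2 * k)) / (1 - t ^+ 2)) ^+ m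
    * t ^+ (m * (n - k)).

(* Main.v *)
(* Write t = q^(1/2), m = p + 1, N = 2p + 1.  After cancelling its prefactor,
   (-1)^s H_(m,s)(t) becomes sum_k a_k c_(p-s,s-k), where
   a_k = (-1)^k C(N,k) / (1 + t^(N-2k)) and c_(a,j) is the coefficient of x^j in
   (1 + tx) / ((1 - x)(1 - t^2 x))^(a+1).  Put Q = (1 - u)(1 - u t^2); a
   three-term recurrence in r shows
   sum_j c_(r-j,j) Q^(r-j) u^j = 1 + ut + ... + (ut)^(2r), so that
   g(u) := sum_(k <= p) a_k (u^k - t^(N-2k) u^(N-k)) equals
   (1 - ut) sum_s (-1)^s (cancelled H_(m,s)) Q^(p-s) u^s.
   Since g(qu) + t^N g(u) = (1 - qu)^N, the recurrence of T_(N,n) in n gives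
   (1 - q)^N T_(N,n) = g(q^n) - (-1)^n t^(Nn) g(1), which is the formula.

   Integrality: it suffices to see that the cancelled H_(m,s) is divisible by
   (1 - t)^(2s) in the local ring at t = 1, the factor (1 + t)^s being visible
   on each summand.  By the functional equation all g(q^n) are divisible by
   (1 - t)^N as soon as g(1) is, and an N-th finite difference in n turns
   g(1) into (1 + t^N)^N g(1).  The cancelled H_(m,s) are then recovered by
   Newton interpolation from the values at u = q^n, because the nodes
   (1 - q^n)(1 - q^(n+1)) / ((1 - t)^2 q^n) differ by units. *)
Require Import Defs.
From mathcomp Require Import all_boot all_order all_algebra.
From mathcomp Require Import ring zify.
Import Order.TTheory GRing.Theory Num.Theory.
Set Implicit Arguments. Unset Strict Implicit. Unset Printing Implicit Defensive.
Local Open Scope ring_scope.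

(** * The kernel coefficients c_(a,j) and their summation *)

Section Kernel.
Variable (R : comNzRingType) (t : R).

(** The coefficient of x^i in 1 / (1 - x)^(a+1). Likewise [beta b l] is the coefficient of x^l in (1
    + t x) / (1 - t^2 x)^(b+1), and [conv] keeps a and b separate so that each exponent can be
    lowered on its own by Pascal's rule. *)
Definition alpha (a i : nat) : R := 'C(a + i, i)%:R.

Definition beta (a l : nat) : R :=
  'C(a + l, l)%:R * t ^+ (2 * l)
  + (if l is l'.+1 then 'C(a + l', l')%:R * t ^+ (2 * l').+1 else 0).

Definition conv (a b j : nat) : R :=
  \sum_(i < j.+1) alpha a i * beta b (j - i).

(* The coefficient of [x^j] in [(1 + t x) / ((1 - x) (1 - t^2 x))^(a+1)]. *)
Definition cof (a j : nat) : R := conv a a j.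

Lemma alpha0 a : alpha a 0 = 1.
Proof. by rewrite /alpha bin0. Qed.

Lemma beta0 b : beta b 0 = 1.
Proof. by rewrite /beta bin0 muln0 expr0 mul1r addr0. Qed.

Lemma alphaS a i : alpha a.+1 i.+1 = alpha a.+1 i + alpha a i.+1.
Proof. by rewrite /alpha addSn addnS binS natrD addSn addrC. Qed.

Lemma betaS a l : beta a.+1 l.+1 = t ^+ 2 * beta a.+1 l + beta a l.+1.
Proof.
have E i : 'C(a.+1 + i.+1, i.+1)%:R = 'C(a.+1 + i, i)%:R + 'C(a + i.+1, i.+1)%:R :> R.
  exact: alphaS.
rewrite /beta E mulnS !exprS.
by case: l => [|l]; rewrite ?addn0 ?bin0 ?E ?mulnS ?muln0 ?addSn ?exprS; ring.
Qed.

Lemma beta0S l : beta 0 l.+2 = t ^+ 2 * beta 0 l.+1.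
Proof. by rewrite /beta !add0n !binn !mulnS !addSn !add0n !exprS; ring. Qed.

Lemma conv_recl a b j : conv a.+1 b j.+1 = conv a.+1 b j + conv a b j.+1.
Proof.
rewrite /conv big_ord_recl [X in _ = _ + X]big_ord_recl.
rewrite addrCA -big_split /=; congr (_ + _); first by rewrite !alpha0.
by apply: eq_bigr => i _; rewrite subSS -mulrDl -alphaS.
Qed.

Lemma conv_recr a b j : conv a b.+1 j.+1 = t ^+ 2 * conv a b.+1 j + conv a b j.+1.
Proof.
rewrite /conv big_ord_recr [X in _ = _ + X]big_ord_recr /= subnn addrA.
have -> : beta b.+1 0 = beta b 0 by rewrite !beta0.
congr (_ + _); rewrite mulr_sumr -big_split /=.
apply: eq_bigr => i _; rewrite subSn; last by rewrite -ltnS.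
by rewrite betaS mulrDr mulrCA.
Qed.

(** Multiplying the generating series by (1 - x) (1 - t^2 x) lowers a by one. For a = 0 it leaves 1
    + t x, which has no coefficient in degree j + 2. *)
Lemma cof_rec a j :
  cof a j.+2 = (1 + t ^+ 2) * cof a j.+1 - t ^+ 2 * cof a j
               + (if a is a'.+1 then cof a' j.+2 else 0).
Proof.
case: a => [|a]; last first.
  rewrite /cof conv_recl [conv a _ _.+2]conv_recr.
  have -> : conv a a.+1 j.+1 = conv a.+1 a.+1 j.+1 - conv a.+1 a.+1 j.
    by rewrite conv_recl addrAC subrr add0r.
  ring.
have E k : conv 0 0 k.+1 = conv 0 0 k + beta 0 k.+1.
  rewrite /conv big_ord_recl alpha0 mul1r addrC; congr (_ + _).
  by apply: eq_bigr => i _; rewrite /alpha !add0n !binn subSS.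
by rewrite /cof addr0 !E beta0S; ring.
Qed.

Lemma cof0 a : cof a 0 = 1.
Proof. by rewrite /cof /conv big_ord1 alpha0 beta0 mulr1. Qed.

Lemma cof1 a : cof a 1 = (1 + t ^+ 2) * a.+1%:R + t.
Proof.
rewrite /cof /conv !big_ord_recr big_ord0 /= subnn subn0 alpha0 beta0.
by rewrite /alpha /beta addn0 bin0 !addn1 !bin1 muln1 muln0; ring.
Qed.

Lemma cof_sum (u : R) n :
  \sum_(j < n.+1) cof (n - j) j * ((1 - u) * (1 - u * t ^+ 2)) ^+ (n - j) * u ^+ j
  = \sum_(i < (2 * n).+1) (u * t) ^+ i.
Proof.
set Q := (1 - u) * _.
pose F k := \sum_(j < k.+1) cof (k - j) j * Q ^+ (k - j) * u ^+ j.
pose G k := \sum_(i < (2 * k).+1) (u * t) ^+ i.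
have F0 : F 0%N = 1 by rewrite /F big_ord1 cof0; ring.
have F1 : F 1%N = 1 + u * t + (u * t) ^+ 2.
  by rewrite /F !big_ord_recr big_ord0 /= !subnn !subn0 !cof0 !cof1 /Q; ring.
(* The terms j = 0, 1 are split off and [cof_rec] is applied to the others. The coefficients of
   [F k.+1] combine because (1 + t^2) u + Q = 1 + (u t)^2. *)
have Frec k : F k.+2 = (1 + (u * t) ^+ 2) * F k.+1 - (u * t) ^+ 2 * F k.
  have E1 : F k.+1 = Q ^+ k.+1
      + \sum_(j < k.+1) cof (k - j) j.+1 * Q ^+ (k - j) * u ^+ j.+1.
    by rewrite /F big_ord_recl cof0 subn0 mul1r mulr1.
  have E2 : F k.+1 = Q ^+ k.+1 + cof k 1 * Q ^+ k * u
      + \sum_(j < k) cof (k.-1 - j) j.+2 * Q ^+ (k.-1 - j) * u ^+ j.+2.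
    rewrite E1 big_ord_recl subn0 addrA; congr (_ + _ + _).
    apply: eq_bigr => i _; rewrite lift0.
    by rewrite subnS predn_sub.
  have -> : F k.+2 = Q ^+ k.+2 + cof k.+1 1 * Q ^+ k.+1 * u
      + \sum_(j < k.+1) cof (k - j) j.+2 * Q ^+ (k - j) * u ^+ j.+2.
    by rewrite /F big_ord_recl big_ord_recl cof0 subn0 mul1r mulr1 addrA.
  have -> : \sum_(j < k.+1) cof (k - j) j.+2 * Q ^+ (k - j) * u ^+ j.+2
    = (1 + t ^+ 2) * u * (F k.+1 - Q ^+ k.+1) - (u * t) ^+ 2 * F k
      + Q * (F k.+1 - Q ^+ k.+1 - cof k 1 * Q ^+ k * u).
    have -> : F k.+1 - Q ^+ k.+1 - cof k 1 * Q ^+ k * u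
      = \sum_(j < k) cof (k.-1 - j) j.+2 * Q ^+ (k.-1 - j) * u ^+ j.+2.
      by rewrite E2; ring.
    have -> : F k.+1 - Q ^+ k.+1
      = \sum_(j < k.+1) cof (k - j) j.+1 * Q ^+ (k - j) * u ^+ j.+1.
      by rewrite E1; ring.
    under eq_bigr do rewrite cof_rec !mulrDl.
    rewrite big_split /=; congr (_ + _).
      rewrite /F !mulr_sumr -sumrB; apply: eq_bigr => i _.
      by rewrite !exprS; ring.
    (* At the last index j = k the first argument of [cof] is 0 and cannot be lowered, hence the
       bound k in [E2]. For j < k the predecessor [k.-1] is a genuine one. *)
    rewrite big_ord_recr /= subnn !mul0r addr0.
    rewrite mulr_sumr; apply: eq_bigr => i _.
    have -> : (k - i = (k.-1 - i).+1)%N.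
      by rewrite -predn_sub prednK ?subn_gt0.
    by rewrite !exprS; ring.
  by rewrite !cof1 !exprS /Q -[k.+2%:R]natr1; ring.
have Grec k : G k.+1 = G k + (u * t) ^+ (2 * k).+1 + (u * t) ^+ (2 * k).+2.
  by rewrite /G mulnS !big_ord_recr.
suff: F n = G n /\ F n.+1 = G n.+1 by case.
elim: n => [|n [IH1 IH2]].
  have G0 : G 0%N = 1 by rewrite /G big_ord1.
  by rewrite F0 F1 Grec G0 muln0 expr1.
split=> //; rewrite Frec IH1 IH2 !Grec mulnS !exprS; ring.
Qed.

End Kernel.

(** * The sum g(u), its expansion and its functional equation *)

Section Salie.
Variables (F : fieldType) (t : F) (p : nat).

Definition scoef (k : nat) : F :=
  (-1) ^+ k * 'C((2 * p).+1, k)%:R / (1 + t ^+ (2 * (p - k)).+1).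

(* The k-th summand pairs the exponents k and 2p+1-k. *)
Definition gsum (u : F) : F :=
  \sum_(k < p.+1) scoef k * (u ^+ k * (1 - (u * t) ^+ (2 * (p - k)).+1)).

Definition scof (s : nat) : F :=
  \sum_(k < s.+1) scoef k * cof t (p - s) (s - k).

(** Exchange the sums and put s = k + j. The inner sum is [cof_sum] with n = p - k, a geometric sum
    of N - 2k terms in u t, which the factor 1 - u t telescopes. *)
Lemma gsum_expand (u : F) :
  gsum u = (1 - u * t) *
    \sum_(s < p.+1) scof s * ((1 - u) * (1 - u * t ^+ 2)) ^+ (p - s) * u ^+ s.
Proof.
set Q := (1 - u) * _.
pose f k s := scoef k * cof t (p - s) (s - k) * Q ^+ (p - s) * u ^+ s.
have -> : \sum_(s < p.+1) scof s * Q ^+ (p - s) * u ^+ s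
    = \sum_(k < p.+1) \sum_(j < (p - k).+1) f k (j + k)%N.
  transitivity (\sum_(s < p.+1) \sum_(k < p.+1 | (k <= s)%N) f k s).
    apply: eq_bigr => s _; rewrite /scof -mulrA mulr_suml.
    rewrite (big_ord_widen_cond p.+1 xpredT
      (fun k => scoef k * cof t (p - s) (s - k) * (Q ^+ (p - s) * u ^+ s))) //.
    by apply: eq_big => [k|k _]; rewrite ?ltnS // /f !mulrA.
  rewrite (exchange_big_dep xpredT) //=; apply: eq_bigr => k _.
  rewrite -(big_mkord (fun s => (k <= s)%N) (f k)) -(big_mkord xpredT (fun j => f k (j + k)%N)).
  rewrite -subSn -1?ltnS // -(big_addn 0 p.+1 k xpredT (f k)) add0n.
  rewrite (big_cat_nat_idem (addr0 0) (n := k)) //=; last exact: ltnW.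
  rewrite big_nat_cond big1 ?add0r; last first.
    by move=> i /andP[/andP[_ lik]] /leq_ltn_trans/(_ lik); rewrite ltnn.
  rewrite big_nat_cond [RHS]big_nat_cond; apply: eq_bigl => i.
  by case: (leqP k i) => //=; rewrite ?andbT.
rewrite mulr_sumr; apply: eq_bigr => k _.
have -> : \sum_(j < (p - k).+1) f k (j + k)%N
    = scoef k * u ^+ k * \sum_(j < (p - k).+1) cof t (p - k - j) j * Q ^+ (p - k - j) * u ^+ j.
  rewrite mulr_sumr; apply: eq_bigr => j _; rewrite /f addnK exprD.
  by rewrite addnC subnDA; ring.
by rewrite cof_sum -opprB subrX1; ring.
Qed.

(** The binomial terms k and N - k are paired; as N = 2p + 1 is odd, they carry opposite signs. *)
Lemma expr1B_folded (z : F) :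
  (1 - z) ^+ (2 * p).+1 = \sum_(k < p.+1)
     (-1) ^+ k * 'C((2 * p).+1, k)%:R * (z ^+ k * (1 - z ^+ (2 * (p - k)).+1)).
Proof.
rewrite exprBn; under eq_bigr do rewrite -mulr_natr expr1n mulr1.
have -> : (2 * p).+2 = (p.+1 + p.+1)%N by lia.
rewrite big_split_ord /= [X in _ + X](reindex_inj rev_ord_inj) -big_split /=.
apply: eq_bigr => k _; have lekp : (k <= p)%N by rewrite -ltnS.
have -> : (p.+1 + (p.+1 - k.+1) = (2 * p).+1 - k)%N by lia.
rewrite bin_sub; last by lia.
have -> : ((2 * p).+1 - k = k + (2 * (p - k)).+1)%N by lia.
by rewrite !exprD [(-1) ^+ _.+1]exprS exprM sqrrN expr1n expr1n; ring.
Qed.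

Hypothesis t_odd : forall k, 1 + t ^+ (2 * k).+1 != 0.

(** Termwise, with M = N - 2k, the left side contains 1 + t^M - t^(2M) u^M - t^(3M) u^M = (1 + t^M)
    (1 - (t^2 u)^M). The first factor cancels the denominator of [scoef], leaving the folded
    binomial at z = t^2 u. *)
Lemma gsum_rec (u : F) :
  gsum (t ^+ 2 * u) + t ^+ (2 * p).+1 * gsum u = (1 - t ^+ 2 * u) ^+ (2 * p).+1.
Proof.
rewrite expr1B_folded /gsum mulr_sumr -big_split; apply: eq_bigr => k _ /=.
rewrite /scoef; move: (t_odd (p - k)); set M := (2 * (p - k)).+1 => tM.
have -> : t ^+ (2 * p).+1 = t ^+ k * t ^+ k * t ^+ M.
  by rewrite -!exprD; congr (_ ^+ _); rewrite /M; move: (ltn_ord k); lia.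
by rewrite !exprMn; field.
Qed.

End Salie.

(** * From the recurrence of T to the explicit formula *)

Lemma T_recS m n (t : RF) :
  T m n.+1 t = - t ^+ m * T m n t + ((1 - t ^+ (2 * n.+1)) / (1 - t ^+ 2)) ^+ m.
Proof.
rewrite /T big_nat_recr //= subnn muln0 !expr0 mul1r mulr1; congr (_ + _).
rewrite mulr_sumr big_nat_cond [RHS]big_nat_cond; apply: eq_bigr => i /andP[/andP[_ lin] _].
by rewrite subSn -1?ltnS // mulnS exprD !exprS; ring.
Qed.

(** Both sides vanish at n = 0 and satisfy the same first-order recurrence, by [gsum_rec] at u =
    q^n. *)
Lemma T_gsum p n (t : RF) :
    (forall k, 1 + t ^+ (2 * k).+1 != 0) -> 1 - t ^+ 2 != 0 ->
  T (2 * p).+1 n t * (1 - t ^+ 2) ^+ (2 * p).+1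
    = gsum t p (t ^+ (2 * n)) - (-1) ^+ n * t ^+ ((2 * p).+1 * n) * gsum t p 1.
Proof.
move=> t_odd t2; elim: n => [|n IHn].
  by rewrite /T big_geq // !muln0 !expr0 !mul1r subrr mul0r.
rewrite T_recS mulrDl -[X in X + _]mulrA IHn expr_div_n divfK ?expf_neq0 //.
rewrite mulnS exprD -(gsum_rec p t_odd) mulnS exprD [(-1) ^+ n.+1]exprS; ring.
Qed.

Lemma sgnK (R : comNzRingType) k (x : R) : (-1) ^+ k * ((-1) ^+ k * x) = x.
Proof. by rewrite mulrA -expr2 sqrr_sign mul1r. Qed.

Lemma H_scof p s (x : RF) : (s <= p)%N ->
  H p.+1 s x = (\prod_(j < s.+1) (1 + x ^+ (2 * (p - j)).+1))
    / ((1 + x) ^+ s * (1 - x) ^+ (2 * s)) * ((-1) ^+ s * scof x p s).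
Proof.
move=> lesp; rewrite /H.
have E (k : nat) : (k < s.+1)%N ->
    1 + x ^ (2 * p.+1%:Z - 2 * k%:Z - 1) = 1 + x ^+ (2 * (p - k)).+1.
  move=> ltks; have -> // : 2 * p.+1%:Z - 2 * k%:Z - 1 = (2 * (p - k)).+1%:Z by lia.
rewrite !big_mkord; congr (_ / _ * _).
  by apply: eq_bigr => j _; rewrite E.
rewrite /scof mulr_sumr; apply: eq_bigr => k _.
have leks : (k <= s)%N by rewrite -ltnS.
rewrite E // /scoef /cof /conv big_mkord !mulrA; congr (_ * _); last first.
  apply: eq_bigr => i _; have lei : (i <= s - k)%N by rewrite -ltnS.
  rewrite /alpha /beta.
  have -> : p.+1%:Z - s%:Z + i%:Z - 1 = (p - s + i)%:Z by lia.
  have -> : p.+1%:Z - k%:Z - i%:Z - 1 = (p - s + (s - k - i))%:Z by lia.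
  have -> : s%:Z - k%:Z - i%:Z = (s - k - i)%:Z by lia.
  have -> : 2 * s%:Z - 2 * k%:Z - 2 * i%:Z = (2 * (s - k - i))%:Z by lia.
  congr (_ * (_ + _)).
  (* When s - k - i = 0 the lower index of the second binomial is -1, so [binz] gives 0, as does the
     corresponding branch of [beta]. *)
  case Ej : (s - k - i)%N => [|j]; first by rewrite mul0r.
  have -> : j.+1%:Z - 1 = j%:Z by lia.
  have -> : p.+1%:Z - k%:Z - i%:Z - 2 = (p - s + j)%:Z by lia.
  by have -> : (2 * j.+1)%:Z - 1 = (2 * j).+1%:Z by lia.
have -> : 2 * p.+1%:Z - 1 = (2 * p).+1%:Z by lia.
have -> : (-1) ^+ s = (-1) ^+ (s - k) * (-1) ^+ k :> RF by rewrite -exprD subnK.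
(* Now both sides contain (-1)^k squared, so [ring] need not know that this is 1. *)
rewrite -[LHS](sgnK k).
change (binz (2 * p).+1 k)%:~R with ('C((2 * p).+1, k)%:R : RF).
move: (_^-1) => d. ring.
Qed.

(** At u = 1 the factor Q vanishes, so only s = p survives. *)
Lemma gsum1 (F : fieldType) p (t : F) : gsum t p 1 = (1 - t) * scof t p p.
Proof.
rewrite gsum_expand big_ord_recr /= subnn expr0 mulr1 expr1n mulr1 mul1r.
rewrite big1 ?add0r // => i _; rewrite subrr mul0r expr0n.
by rewrite subn_eq0 leqNgt ltn_ord /= mulr0 mul0r.
Qed.

(** Applied with A = (1 + t)^k, B = (1 - t)^(2k), x = 1 - t, y = 1 + t, where x y B A^2 = (1 -
    q)^(2k+1). *)
Lemma cancel_denominators (F : fieldType) (c P A B x y : F) :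
    P != 0 -> A != 0 -> B != 0 -> x != 0 -> y != 0 ->
  P / (A * B) * c / (y * A * P) = c * x / (x * y * (B * A ^+ 2)).
Proof. by move=> P0 A0 B0 x0 y0; field; rewrite P0 A0 B0 x0 y0. Qed.

(** [Tn] and [h] stand for T and H, known only through [T_gsum] and [H_scof], so that the remaining
    algebra takes place in an arbitrary field. *)
Lemma salie_assembly (F : fieldType) p n (t Tn : F) (h : nat -> F) :
    (forall k, 1 + t ^+ (2 * k).+1 != 0) -> 1 - t ^+ 2 != 0 ->
    (forall s, (s <= p)%N ->
      h s = (\prod_(j < s.+1) (1 + t ^+ (2 * (p - j)).+1))
        / ((1 + t) ^+ s * (1 - t) ^+ (2 * s)) * ((-1) ^+ s * scof t p s)) ->
    Tn * (1 - t ^+ 2) ^+ (2 * p).+1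
      = gsum t p (t ^+ (2 * n)) - (-1) ^+ n * t ^+ ((2 * p).+1 * n) * gsum t p 1 ->
  Tn =
    (-1) ^+ (p.+1 + n) * h p * t ^+ ((2 * p).+1 * n)
      / ((1 + t) ^+ p.+1 * \prod_(i < p.+1) (1 + t ^+ (2 * (p - i)).+1))
    + (1 - t ^+ (2 * n).+1) / (1 - t)
      * \sum_(k < p.+1)
          ((-1) ^+ k * h k
           * (1 - t ^+ (2 * n)) ^+ (p - k) * (1 - t ^+ (2 * n).+2) ^+ (p - k)
           * t ^+ (2 * k * n)
           / ((1 - t ^+ 2) ^+ (2 * (p - k)) * (1 + t) ^+ k.+1
              * \prod_(i < k.+1) (1 + t ^+ (2 * (p - i)).+1))).
Proof.
move=> t_odd t2 hE; rewrite gsum1 gsum_expand => TnE.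
have q2 : 1 - t ^+ 2 = (1 - t) * (1 + t) by ring.
have /norP[t1 tN1] : ~~ ((1 - t == 0) || (1 + t == 0)) by rewrite -mulf_eq0 -q2.
have prod0 k : \prod_(i < k.+1) (1 + t ^+ (2 * (p - i)).+1) != 0.
  by apply/prodf_neq0 => i _; exact: t_odd.
have E k : (k <= p)%N -> (-1) ^+ k * h k / ((1 + t) ^+ k.+1
              * \prod_(i < k.+1) (1 + t ^+ (2 * (p - i)).+1))
    = scof t p k * (1 - t) / (1 - t ^+ 2) ^+ (2 * k).+1.
  move=> lekp; rewrite hE // mulrCA sgnK [_ ^+ k.+1]exprS.
  rewrite (@cancel_denominators _ _ _ _ _ (1 - t)) ?expf_neq0 //.
  by rewrite q2 [in RHS]exprS exprMn -exprM (mulnC k).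
set D := (1 - t ^+ 2) ^+ (2 * p).+1 in TnE.
have D0 : D != 0 by rewrite expf_neq0.
(* The g(1) part of [TnE] gives the first summand of the formula, the expansion of g(q^n) the
   second. *)
apply: (mulIf D0); rewrite TnE [RHS]mulrDl [LHS]addrC; congr (_ + _).
  have := E p (leqnn p); rewrite -/D; set X := (_ * _)^-1 => EE.
  have -> : (-1) ^+ (p.+1 + n) * h p * t ^+ ((2 * p).+1 * n) * X
     = - (-1) ^+ n * t ^+ ((2 * p).+1 * n) * ((-1) ^+ p * h p * X).
    by rewrite addSn exprS exprD; ring.
  by rewrite EE; field.
rewrite -exprSr -[RHS]mulrA -[RHS]mulrA; congr (_ * _).
rewrite mulr_suml mulr_sumr; apply: eq_bigr => k _.
have lekp : (k <= p)%N by rewrite -ltnS.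
rewrite -exprM -[_ * t ^+ 2]exprD addn2 exprMn [(2 * n * k)%N]mulnAC.
have q0 j : (1 - t ^+ 2) ^+ j != 0 by rewrite expf_neq0.
have -> : D = (1 - t ^+ 2) ^+ (2 * (p - k)) * (1 - t ^+ 2) ^+ (2 * k).+1.
  by rewrite -exprD; congr (_ ^+ _); lia.
set u := (1 - t ^+ (2 * n)) ^+ _; set v := (1 - _) ^+ _; set w := t ^+ _.
move: (E k lekp); rewrite !invfM.
set y := ((1 + t) ^+ k.+1)^-1; set z := (\prod_(i < k.+1) _)^-1 => {}E.
have -> : (-1) ^+ k * h k * u * v * w
    * ((1 - t ^+ 2) ^- (2 * (p - k)) * y * z)
  = (-1) ^+ k * h k * (y * z) * (u * v * w / (1 - t ^+ 2) ^+ (2 * (p - k))).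
  by ring.
by rewrite E; field; rewrite t1 !q0.
Qed.

Lemma salie_formula p n (t : RF) :
    (forall k, 1 + t ^+ (2 * k).+1 != 0) -> 1 - t ^+ 2 != 0 ->
  T (2 * p).+1 n t =
    (-1) ^+ (p.+1 + n) * H p.+1 p t * t ^+ ((2 * p).+1 * n)
      / ((1 + t) ^+ p.+1 * \prod_(i < p.+1) (1 + t ^+ (2 * (p - i)).+1))
    + (1 - t ^+ (2 * n).+1) / (1 - t)
      * \sum_(k < p.+1)
          ((-1) ^+ k * H p.+1 k t
           * (1 - t ^+ (2 * n)) ^+ (p - k) * (1 - t ^+ (2 * n).+2) ^+ (p - k)
           * t ^+ (2 * k * n)
           / ((1 - t ^+ 2) ^+ (2 * (p - k)) * (1 + t) ^+ k.+1
              * \prod_(i < k.+1) (1 + t ^+ (2 * (p - i)).+1))).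
Proof.
move=> t_odd t2; apply: (salie_assembly (h := fun k => H p.+1 k t) t_odd t2).
  by move=> s; exact: H_scof.
exact: T_gsum.
Qed.

(** * Newton interpolation with integrality *)

(** Divided differences stay in P because the node differences have inverses in P. The induction
    passes from f to (f - f(x_0)) / (X - x_0), of smaller degree, at the shifted nodes. *)
Lemma newton_integrality (K : fieldType) (P : K -> Prop) :
    (forall x y, P x -> P y -> P (x - y)) -> (forall x y, P x -> P y -> P (x * y)) ->
  forall n (f : {poly K}) (x : nat -> K), (size f <= n)%N ->
    (forall i, P (x i)) ->
    (forall i j, (i < j)%N -> x j - x i != 0 /\ P (x j - x i)^-1) ->
    (forall i, P f.[x i]) -> forall k, P f`_k.
Proof.
move=> PB PM n; elim: n => [|n IHn] f x lef Px dx Pf k; have P0 : P 0 by rewrite -(subrr (x 0%N)); apply: PB.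
  by move: lef; rewrite leqn0 size_poly_eq0 => /eqP->; rewrite coef0.
have PD y z : P y -> P z -> P (y + z).
  by move=> Py Pz; rewrite -[z]opprK -[- z]sub0r; apply: (PB) => //; apply: PB.
have /factor_theorem[g fE] : root (f - f.[x 0%N]%:P) (x 0%N).
  by rewrite /root hornerD hornerN hornerC subrr.
have szg : (size g <= n)%N.
  have [->|g0] := eqVneq g 0; first by rewrite size_poly0.
  have sz : size (g * ('X - (x 0%N)%:P)) = (size g).+1.
    by rewrite size_Mmonic ?monicXsubC // size_XsubC addn2.
  rewrite -ltnS -sz -fE (leq_trans (size_polyD _ _)) // geq_max lef size_polyN.
  by rewrite (leq_trans (size_polyC_leq1 _)).
have Pg : forall k, P g`_k.
  apply: (IHn g (fun i => x i.+1)) => // [i j ltij|i].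
    exact: dx.
  have [d0 Pd] := dx 0%N i.+1 isT.
  have -> : g.[x i.+1] = (f.[x i.+1] - f.[x 0%N]) * (x i.+1 - x 0%N)^-1.
    apply: (mulIf d0); rewrite divfK //.
    by move/(congr1 (horner^~ (x i.+1))): fE; rewrite !hornerE => ->.
  by apply: PM => //; apply: PB.
have -> : f = f.[x 0%N]%:P + (g * 'X - (x 0%N) *: g).
  by rewrite -mul_polyC [_%:P * g]mulrC -mulrBr -fE addrC subrK.
rewrite coefD coefB coefZ coefMX coefC.
apply: PD; first by case: ifP.
by apply: PB; [case: ifP | apply: PM].
Qed.

(** * Divisibility of g(q^n) by (1 - t)^N in the local ring *)

Section Local.
Variables (F : fieldType) (phi : {rmorphism {poly int} -> F}).
Hypothesis phi_inj : injective phi.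
Let t := phi 'X.

(* The local ring at t = 1. *)
Definition loc (x : F) : Prop :=
  exists a b : {poly int}, b.[1] != 0 /\ x = phi a / phi b.

Definition vloc n (x : F) : Prop := exists2 y, loc y & x = (1 - t) ^+ n * y.

Lemma phi_neq0 (b : {poly int}) : b.[1] != 0 -> phi b != 0.
Proof.
by apply: contra => /eqP pb; rewrite (phi_inj (etrans pb (esym (rmorph0 phi)))) horner0.
Qed.

Lemma loc_phi a : loc (phi a).
Proof. by exists a, 1; rewrite rmorph1 divr1 hornerC oner_eq0. Qed.

Lemma loc_inv b : b.[1] != 0 -> loc (phi b)^-1.
Proof. by move=> b1; exists 1, b; rewrite rmorph1 mul1r. Qed.

Lemma locM x y : loc x -> loc y -> loc (x * y).
Proof.
move=> [a [b [b1 ->]]] [c [d [d1 ->]]]; exists (a * c), (b * d).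
by rewrite hornerM mulf_neq0 // !rmorphM mulf_div.
Qed.

Lemma locB x y : loc x -> loc y -> loc (x - y).
Proof.
move=> [a [b [b1 ->]]] [c [d [d1 ->]]]; exists (a * d - c * b), (b * d).
rewrite hornerM mulf_neq0 //; split=> //.
by rewrite rmorphB !rmorphM; field; rewrite !phi_neq0.
Qed.

Lemma loc0 : loc 0. Proof. by rewrite -(rmorph0 phi); exact: loc_phi. Qed.
Lemma loc1 : loc 1. Proof. by rewrite -(rmorph1 phi); exact: loc_phi. Qed.

Lemma locX x n : loc x -> loc (x ^+ n).
Proof. by move=> lx; elim: n => [|n IHn]; [exact: loc1 | rewrite exprS; exact: locM]. Qed.

Lemma loc_t : loc t. Proof. exact: loc_phi. Qed.

Lemma vlocB n x y : vloc n x -> vloc n y -> vloc n (x - y).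
Proof.
by move=> [a la ->] [b lb ->]; exists (a - b); [exact: locB | rewrite mulrBr].
Qed.

Lemma vlocM n x y : loc x -> vloc n y -> vloc n (x * y).
Proof. by move=> lx [b lb ->]; exists (x * b); [exact: locM | rewrite mulrCA]. Qed.

Lemma vloc0 n : vloc n 0. Proof. by exists 0; [exact: loc0 | rewrite mulr0]. Qed.

Lemma vlocD n x y : vloc n x -> vloc n y -> vloc n (x + y).
Proof.
move=> vx vy; rewrite -[y]opprK -[- y]sub0r; apply: vlocB => //.
by apply: vlocB => //; exact: vloc0.
Qed.

Lemma vloc_sum n I (r : seq I) (E : I -> F) :
  (forall i, vloc n (E i)) -> vloc n (\sum_(i <- r) E i).
Proof.
by move=> vE; elim/big_ind: _ => // [|x y]; [exact: vloc0 | exact: vlocD].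
Qed.

(** The quotient (1 - X^k) / (1 - X), an analogue of the integer k. For k > 0 it is a unit of the
    local ring, since nonzero integers are units there. *)
Definition geom k : {poly int} := \sum_(i < k) 'X^i.

Lemma geom1 k : (geom k).[1] = k%:R.
Proof.
rewrite /geom horner_sum (eq_bigr (fun _ => 1)) => [|i _].
  by rewrite sumr_const card_ord.
by rewrite hornerXn expr1n.
Qed.

Lemma geomE k : 1 - t ^+ k = (1 - t) * phi (geom k).
Proof.
by rewrite -opprB subrX1 -mulNr opprB /geom rmorph_sum; congr (_ * _);
  apply: eq_bigr => i _; rewrite rmorphXn.
Qed.

Lemma vloc_1BX n k : vloc n ((1 - t ^+ k) ^+ n).
Proof.
exists (phi (geom k) ^+ n); first by apply: locX; exact: loc_phi.
by rewrite geomE exprMn.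
Qed.

Lemma oddE k : 1 + t ^+ k = phi (1 + 'X^k).
Proof. by rewrite rmorphD rmorph1 rmorphXn. Qed.

Lemma odd1 k : (1 + 'X^k : {poly int}).[1] != 0.
Proof. by rewrite hornerD hornerC hornerXn expr1n. Qed.

Lemma t_odd k : 1 + t ^+ (2 * k).+1 != 0.
Proof. by rewrite oddE phi_neq0 ?odd1. Qed.

Lemma loc_scoef p k : loc (scoef t p k).
Proof.
rewrite /scoef oddE; apply: locM; last by apply: loc_inv; exact: odd1.
rewrite -(rmorph1 phi) -rmorphN -rmorphXn -rmorphMn -rmorphM.
exact: loc_phi.
Qed.

Variable p : nat.
Let N := (2 * p).+1.

(** Iterating the functional equation from u = 1 only adds multiples of the terms (1 - q^j)^N, each
    divisible by (1 - t)^N. *)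
Lemma vloc_gsum_diff n :
  vloc N (gsum t p (t ^+ (2 * n)) - (- t ^+ N) ^+ n * gsum t p 1).
Proof.
elim: n => [|n IHn]; first by rewrite muln0 !expr0 mul1r subrr; exact: vloc0.
have -> : gsum t p (t ^+ (2 * n.+1)) - (- t ^+ N) ^+ n.+1 * gsum t p 1
    = (1 - t ^+ (2 * n.+1)) ^+ N
      - t ^+ N * (gsum t p (t ^+ (2 * n)) - (- t ^+ N) ^+ n * gsum t p 1).
  rewrite mulnS exprD -(gsum_rec p t_odd) [(- _) ^+ n.+1]exprS.
  by move: ((- _) ^+ n) => e; rewrite /N; ring.
apply: vlocB; first exact: vloc_1BX.
by apply: vlocM => //; apply: locX; exact: loc_t.
Qed.

(* In the N-th finite difference in n of vloc_gsum_diff, the factor of gsum 1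
   sums to the unit (1 + t^N)^N. *)
Lemma vloc_gsum1 : vloc N (gsum t p 1).
Proof.
pose c (n : nat) : F := (-1) ^+ n * 'C(N, n)%:R.
have sumc (x : F) : \sum_(n < N.+1) c n * x ^+ n = (1 - x) ^+ N.
  rewrite exprBn; apply: eq_bigr => i _.
  by rewrite expr1n -[in RHS]mulr_natr /c; ring.
have lc n : loc (c n).
  rewrite /c -(rmorph1 phi) -rmorphN -rmorphXn -rmorphMn -rmorphM.
  exact: loc_phi.
have E : (1 + t ^+ N) ^+ N * gsum t p 1
    = \sum_(n < N.+1) c n * gsum t p (t ^+ (2 * n))
      - \sum_(n < N.+1) c n * (gsum t p (t ^+ (2 * n)) - (- t ^+ N) ^+ n * gsum t p 1).
  rewrite -[t ^+ N in LHS]opprK -sumc mulr_suml -sumrB.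
  by apply: eq_bigr => n _; ring.
have -> : gsum t p 1 = ((phi (1 + 'X^N)) ^+ N)^-1 * ((1 + t ^+ N) ^+ N * gsum t p 1).
  by rewrite -oddE mulKf // expf_neq0 // t_odd.
apply: vlocM; first by rewrite -exprVn; apply: locX; apply: loc_inv; exact: odd1.
rewrite E; apply: vlocB; last first.
  by apply: vloc_sum => n; apply: vlocM => //; exact: vloc_gsum_diff.
(* With M = N - 2k, g(q^n) is a combination of q^(nk) and q^(n(k+M)). The finite difference turns
   them into N-th powers of 1 - q^k and 1 - q^(k+M). *)
have -> : \sum_(n < N.+1) c n * gsum t p (t ^+ (2 * n))
    = \sum_(k < p.+1) scoef t p k * ((1 - t ^+ (2 * k)) ^+ N
       - t ^+ (2 * (p - k)).+1 * (1 - t ^+ (2 * (k + (2 * (p - k)).+1))) ^+ N).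
  under eq_bigr do rewrite /gsum mulr_sumr.
  rewrite exchange_big; apply: eq_bigr => k _ /=.
  rewrite -!sumc mulr_sumr -sumrB mulr_sumr; apply: eq_bigr => n _.
  set M := (2 * (p - k)).+1; rewrite exprMn -!exprM.
  have -> : (2 * (k + M) * n = 2 * n * k + 2 * n * M)%N by lia.
  have -> : (2 * k * n = 2 * n * k)%N by lia.
  by rewrite exprD; ring.
apply: vloc_sum => k; apply: vlocM; first exact: loc_scoef.
apply: vlocB; first exact: vloc_1BX.
by apply: vlocM; [apply: locX; exact: loc_t | exact: vloc_1BX].
Qed.

Lemma vloc_gsum n : vloc N (gsum t p (t ^+ (2 * n))).
Proof.
rewrite -[gsum _ _ _](subrK ((- t ^+ N) ^+ n * gsum t p 1)).
apply: vlocD; first exact: vloc_gsum_diff.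
apply: vlocM vloc_gsum1; apply: locX; rewrite -sub0r; apply: locB loc0 _.
by apply: locX; exact: loc_t.
Qed.

End Local.

(** * Divisibility of the coefficients by interpolation at the nodes *)

Section Interpolation.
Variables (F : fieldType) (phi : {rmorphism {poly int} -> F}).
Hypothesis phi_inj : injective phi.
Let t := phi 'X.
Local Notation loc := (loc phi).
Local Notation vloc := (vloc phi).
Variable p : nat.

Lemma one_sub_t_neq0 : 1 - t != 0.
Proof.
rewrite -(rmorph1 phi) -rmorphB -(rmorph0 phi) (inj_eq phi_inj).
apply/eqP => /(congr1 (horner^~ 0)) /eqP.
by rewrite hornerD hornerN hornerX hornerC horner0 subr0 oner_eq0.
Qed.

Lemma X1_neq0 n : ('X^n : {poly int}).[1] != 0.
Proof. by rewrite hornerXn expr1n. Qed.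

(* (1 - q^n) (1 - q^(n+1)) / ((1 - t)^2 q^n) with q = t^2. *)
Definition node n : F := phi (geom (2 * n) * geom (2 * n).+2) / phi 'X^(2 * n).

Lemma node_loc n : loc (node n).
Proof. by eexists _, _; split; last reflexivity; exact: X1_neq0. Qed.

(** Over a common denominator, the numerator takes the value 4 (j (j + 1) - i (i + 1)) at t = 1,
    which is nonzero for i < j. *)
Lemma node_sub i j : (i < j)%N -> node j - node i != 0 /\ loc (node j - node i)^-1.
Proof.
move=> ltij.
pose D := geom (2 * j) * geom (2 * j).+2 * 'X^(2 * i)
          - geom (2 * i) * geom (2 * i).+2 * 'X^(2 * j).
have D1 : D.[1] != 0.
  by rewrite /D hornerD hornerN !hornerM !geom1 !hornerXn !expr1n !mulr1; nia.
have -> : node j - node i = phi D / phi ('X^(2 * j) * 'X^(2 * i)).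
  rewrite /D /node rmorphB !(rmorphM phi); field.
  by rewrite !phi_neq0 ?X1_neq0.
have D0 := phi_neq0 phi_inj D1.
split; first by rewrite mulf_neq0 // invr_eq0 phi_neq0 // hornerM mulf_neq0 ?X1_neq0.
by rewrite invf_div; eexists _, _; split; last reflexivity.
Qed.

Lemma scof_vloc s : (s <= p)%N -> vloc (2 * s) (scof t p s).
Proof.
move=> lesp; have e0 := one_sub_t_neq0.
have en0 n : (1 - t) ^+ n != 0 by rewrite expf_neq0.
(* The order is reversed because Q^(p-s) u^s = u^p (Q / u)^(p-s), and Q / u at u = q^n is (1 - t)^2
   [node n]. Hence g(q^n) is f at that node times (1 - t)^N and units. *)
pose f := \poly_(i < p.+1) (scof t p (p - i) / (1 - t) ^+ (2 * (p - i))).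
suff: loc f`_(p - s).
  rewrite coef_poly ltnS leq_subr subKn // => lf.
  by exists (scof t p s / (1 - t) ^+ (2 * s)) => //; rewrite mulrC divfK.
apply: (newton_integrality (@locB _ _ phi_inj) (@locM _ phi) (n := p.+1) (x := node)).
- exact: size_poly.
- exact: node_loc.
- exact: node_sub.
move=> n; have Xn0 : t ^+ (2 * n) != 0.
  by rewrite expf_neq0 // phi_neq0 // hornerX oner_eq0.
have gE : gsum t p (t ^+ (2 * n))
    = (1 - t) ^+ (2 * p).+1 * phi (geom (2 * n).+1) * (t ^+ (2 * n)) ^+ p * f.[node n].
  rewrite gsum_expand -exprSr geomE [(1 - t) ^+ _.+1]exprS horner_poly -!mulrA.
  congr (_ * _); rewrite [RHS]mulrCA; congr (_ * _).
  rewrite [in RHS](reindex_inj rev_ord_inj) mulr_sumr mulr_sumr.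
  apply: eq_bigr => k _; have lek : (k <= p)%N by rewrite -ltnS.
  rewrite /= subSS subKn // -[t ^+ (2 * n) * _]exprD addn2 !geomE -/t /node.
  have pE (x : F) : x ^+ p = x ^+ (p - k) * x ^+ k by rewrite -exprD subnK.
  rewrite ![(1 - t) ^+ (2 * _)]exprM !pE !rmorphM rmorphXn -/t.
  set Y := t ^+ (2 * n) in Xn0 *; set g1 := phi _; set g2 := phi _.
  have -> : (1 - t) * g1 * ((1 - t) * g2) = (1 - t) ^+ 2 * (g1 * g2) by ring.
  rewrite expr_div_n exprMn; field.
  by rewrite expf_neq0 // expf_neq0 // expf_neq0.
have [y ly yE] := vloc_gsum phi_inj p n.
have -> : f.[node n] = y * (phi (geom (2 * n).+1))^-1 * (phi ('X^(2 * n * p)))^-1.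
  have g0 : phi (geom (2 * n).+1) != 0 by apply: phi_neq0 => //; rewrite geom1 pnatr_eq0.
  rewrite rmorphXn exprM; apply: (mulfI (en0 (2 * p).+1)).
  rewrite !mulrA -yE gE -/t; field.
  by rewrite g0 expf_neq0.
apply: locM; [apply: locM => // |]; apply: loc_inv; last exact: X1_neq0.
by rewrite geom1 pnatr_eq0.
Qed.
End Interpolation.

(** * From local divisibility to polynomials over the integers *)

Lemma rmorph_cof (R S : comNzRingType) (f : {rmorphism R -> S}) x a j :
  f (cof x a j) = cof (f x) a j.
Proof.
rewrite /cof /conv rmorph_sum; apply: eq_bigr => i _.
rewrite rmorphM rmorph_nat; congr (_ * _).
rewrite /beta rmorphD rmorphM rmorph_nat rmorphXn; congr (_ + _).
by case: (j - i)%N => [|l]; rewrite ?rmorph0 // rmorphM rmorph_nat rmorphXn.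
Qed.

Lemma dvd_one_add_odd (R : comNzRingType) (x : R) k :
  exists y, 1 + x ^+ (2 * k).+1 = (1 + x) * y.
Proof.
exists (\sum_(i < (2 * k).+1) x ^+ ((2 * k).+1.-1 - i) * (-1) ^+ i).
have := subrXX x (-1) (2 * k).+1.
by rewrite -signr_odd /= mul2n odd_double expr1 !opprK addrC [x + 1]addrC.
Qed.

Section Numerator.
Variables p s : nat.

Definition scof_num : {poly int} :=
  \sum_(k < s.+1) (-1) ^+ k * 'C((2 * p).+1, k)%:R
    * (\prod_(j < s.+1 | j != k) (1 + 'X ^+ (2 * (p - j)).+1)) * cof 'X (p - s) (s - k).

Lemma scof_numE (F : fieldType) (f : {rmorphism {poly int} -> F}) :
    (forall k, 1 + f 'X ^+ (2 * k).+1 != 0) ->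
  f scof_num = (\prod_(j < s.+1) (1 + f 'X ^+ (2 * (p - j)).+1)) * scof (f 'X) p s.
Proof.
move=> f_odd; rewrite /scof_num /scof rmorph_sum mulr_sumr.
apply: eq_bigr => k _; rewrite [in RHS](bigD1 k) //= !rmorphM rmorph_cof rmorph_prod.
rewrite rmorphXn rmorphN1 rmorph_nat /scoef.
under eq_bigr do rewrite rmorphD rmorph1 rmorphXn.
by field.
Qed.

(** Each summand keeps s factors 1 + X^M with M odd, and each of these is divisible by 1 + X. *)
Lemma scof_num_dvd : exists g, scof_num = (1 + 'X) ^+ s * g.
Proof.
have D k : exists y : {poly int}, 1 + 'X ^+ (2 * k).+1 == (1 + 'X) * y.
  by have [y ->] := dvd_one_add_odd ('X : {poly int}) k; exists y.
pose y k := xchoose (D k).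
have yE k : 1 + 'X ^+ (2 * k).+1 = (1 + 'X) * y k by apply/eqP; exact: (xchooseP (D k)).
exists (\sum_(k < s.+1) (-1) ^+ k * 'C((2 * p).+1, k)%:R
    * (\prod_(j < s.+1 | j != k) y (p - j)%N) * cof 'X (p - s) (s - k)).
rewrite mulr_sumr; apply: eq_bigr => k _.
under [in LHS]eq_bigr => j _ do rewrite yE.
rewrite big_split /= prodr_const.
by rewrite cardC1 card_ord /=; ring.
Qed.

End Numerator.

(** As d does not vanish at 1, g must; one factor 1 - X is removed at a time. This descends
    divisibility from the local ring to polynomials. *)
Lemma dvd_coprime_at1 (R : idomainType) n (c d g : {poly R}) :
  d.[1] != 0 -> g * d = (1 - 'X) ^+ n * c -> exists e, g = (1 - 'X) ^+ n * e.
Proof.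
move=> d1; elim: n => [|n IHn] in c g *; first by exists g; rewrite mul1r.
rewrite exprS => E.
have /factor_theorem[h hE] : root g 1.
  have /eqP := congr1 (horner^~ 1) E.
  rewrite !hornerM hornerD hornerN hornerC hornerX subrr !mul0r mulf_eq0.
  by rewrite (negPf d1) orbF.
have X1 : (1 - 'X : {poly R}) != 0 by rewrite -opprB oppr_eq0 polyXsubC_eq0.
have [|e eE] := IHn c (- h).
  by apply: (mulfI X1); rewrite mulrA [RHS]mulrA -E hE polyC1; ring.
by exists e; rewrite -mulrA -eE hE polyC1; ring.
Qed.

Definition evq d (a : {poly int}) : RF := polyF (a \Po 'X^d).

Lemma evq_rmorph d : exists2 f : {rmorphism {poly int} -> RF},
  forall a, f a = evq d a & f 'X = tq ^+ d.
Proof.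
exists (@FracField.tofrac {poly int} \o comp_poly 'X^d : {rmorphism {poly int} -> RF}) => //.
by rewrite /= comp_polyX rmorphXn.
Qed.

Lemma polyF_inj : injective polyF.
Proof. by move=> a b /eqP; rewrite /polyF tofrac_eq => /eqP. Qed.

(** Substituting X^d with d > 0 preserves the constant term. *)
Lemma evq_neq0 d (a : {poly int}) : (0 < d)%N -> a.[0] != 0 -> evq d a != 0.
Proof.
move=> d0; apply: contra; rewrite /evq /polyF tofrac_eq0.
by move/eqP/(congr1 (horner^~ 0)); rewrite horner_comp hornerXn expr0n gtn_eqF // horner0 => ->.
Qed.


Lemma scof_num_factor (F : fieldType) (f : {rmorphism {poly int} -> F}) p s :
    injective f -> (s <= p)%N ->
  exists e, scof_num p s = (1 + 'X) ^+ s * ((1 - 'X) ^+ (2 * s) * e).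
Proof.
move=> f_inj lesp; have [g gE] := scof_num_dvd p s.
have [_ [a [b [b1 ->]]] scofE] := scof_vloc f_inj lesp.
pose P : {poly int} := \prod_(j < s.+1) (1 + 'X ^+ (2 * (p - j)).+1).
have fP : f P = \prod_(j < s.+1) (1 + f 'X ^+ (2 * (p - j)).+1).
  by rewrite rmorph_prod; apply: eq_bigr => j _; rewrite rmorphD rmorph1 rmorphXn.
suff [e eE] : exists e, g = (1 - 'X) ^+ (2 * s) * e by exists e; rewrite gE eE.
(* The local quotient is a / b; clearing b and (1 + X)^s leaves a cofactor with value 2^s b(1) at
   1. *)
apply: (@dvd_coprime_at1 _ _ (P * a) ((1 + 'X) ^+ s * b)).
  rewrite hornerM mulf_neq0 // horner_exp expf_neq0 //.
  by rewrite hornerD hornerC hornerX.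
rewrite mulrA [g * _]mulrC -gE; apply: (f_inj).
rewrite !rmorphM (scof_numE p s (t_odd f_inj)) scofE fP rmorphXn rmorphB rmorph1.
by have b0 := phi_neq0 f_inj b1; field.
Qed.

Lemma H_polynomial p s : (s <= p)%N ->
  exists e : {poly int}, forall d, (0 < d)%N -> H p.+1 s (tq ^+ d) = evq d e.
Proof.
move=> lesp; have [f1 f1E _] := evq_rmorph 1.
have f1_inj : injective f1.
  by move=> a b; rewrite !f1E /evq expr1 !comp_polyXr; exact: polyF_inj.
have [e eE] := scof_num_factor f1_inj lesp.
(* The witness precedes d: the factorization holds among integer polynomials and so survives every
   substitution of t^d for X. *)
exists ((-1) ^+ s * e) => d d0; have [f fE fX] := evq_rmorph d.
have f0 (a : {poly int}) : a.[0] != 0 -> f a != 0.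
  by move=> a0; rewrite fE; exact: evq_neq0.
have f_odd k : 1 + f 'X ^+ (2 * k).+1 != 0.
  rewrite -(rmorph1 f) -rmorphXn -rmorphD; apply: f0.
  by rewrite hornerD hornerC hornerXn expr0n addr0 oner_eq0.
have D0 : f ((1 + 'X) ^+ s * (1 - 'X) ^+ (2 * s)) != 0.
  apply: f0; rewrite hornerM !horner_exp !hornerD hornerN hornerC hornerX.
  by rewrite ?addr0 ?subr0 !expr1n mulr1 oner_eq0.
rewrite -fE -fX (H_scof _ lesp) mulrCA mulrAC -(scof_numE p s f_odd) eE.
have -> : (1 + f 'X) ^+ s * (1 - f 'X) ^+ (2 * s)
    = f ((1 + 'X) ^+ s * (1 - 'X) ^+ (2 * s)).
  by rewrite rmorphM !rmorphXn rmorphD rmorphB rmorph1.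
rewrite [(1 + 'X) ^+ s * (_ * e)]mulrA [f (_ * e)]rmorphM [f (_ * e)]rmorphM.
by rewrite rmorphXn rmorphN1 [f _ * f e]mulrC mulfK.
Qed.

(** * Nonvanishing of the denominators and conclusion *)

Lemma tq_odd k : 1 + tq ^+ (2 * k).+1 != 0.
Proof.
have [f fE fX] := evq_rmorph 1.
rewrite -[tq]expr1 -fX -(rmorph1 f) -rmorphXn -rmorphD fE; apply: evq_neq0 => //.
by rewrite hornerD hornerC hornerXn expr0n addr0 oner_eq0.
Qed.

Lemma one_sub_q_neq0 : 1 - tq ^+ 2 != 0.
Proof.
have [f fE fX] := evq_rmorph 1.
rewrite -[tq]expr1 -fX -(rmorph1 f) -rmorphXn -rmorphB fE; apply: evq_neq0 => //.
by rewrite hornerD hornerN hornerC hornerXn expr0n subr0 oner_eq0.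
Qed.

Unset Implicit Arguments.

(* t := tq stands for q^{1/2}; so q = tq^+2, q^{1/2} = tq,
   q^{mn - n/2} = tq^(2mn - n), q^{m-i-1/2} = tq^(2m-2i-1), q^{n+1/2} = tq^(2n+1). *)
Theorem theorem1p4 (m n : nat) (hm : (1 <= m)%N) (hn : (1 <= n)%N) :
  (forall s : nat, (s <= m - 1)%N ->
     exists p : {poly int}, H m s (tq ^+ 2) = polyF (p \Po 'X^2))
  /\
  T (2 * m - 1) n tq =
    (-1) ^+ (m + n) * H m (m - 1) tq
      * tq ^+ (2 * m * n - n)
      / ((1 + tq) ^+ m
         * \prod_(0 <= i < m) (1 + tq ^+ (2 * m - 2 * i - 1)))
    + (1 - tq ^+ (2 * n + 1)) / (1 - tq)
      * \sum_(0 <= k < m)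
          ((-1) ^+ k * H m k tq
           * (1 - tq ^+ (2 * n)) ^+ (m - k - 1)
           * (1 - tq ^+ (2 * n + 2)) ^+ (m - k - 1)
           * tq ^+ (2 * k * n)
           / ((1 - tq ^+ 2) ^+ (2 * m - 2 * k - 2)
              * (1 + tq) ^+ k.+1
              * \prod_(0 <= i < k.+1) (1 + tq ^+ (2 * m - 2 * i - 1)))).
Proof.
case: m hm => [//|p] _; rewrite subn1 /=; split=> [s lesp|].
  by have [e eE] := H_polynomial lesp; exists e; exact: eE.
have prodE k : (k <= p)%N ->
    \prod_(0 <= i < k.+1) (1 + tq ^+ (2 * p.+1 - 2 * i - 1))
    = \prod_(i < k.+1) (1 + tq ^+ (2 * (p - i)).+1).
  move=> lekp; rewrite big_mkord; apply: eq_bigr => i _.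
  by have -> : (2 * p.+1 - 2 * i - 1 = (2 * (p - i)).+1)%N by move: (ltn_ord i); lia.
have -> : (2 * p.+1 - 1 = (2 * p).+1)%N by lia.
have -> : (2 * p.+1 * n - n = (2 * p).+1 * n)%N by lia.
rewrite addn1 addn2 (salie_formula p n tq_odd one_sub_q_neq0) prodE // big_mkord.
congr (_ + _ * _); apply: eq_bigr => k _; have lekp : (k <= p)%N by rewrite -ltnS.
rewrite prodE //.
have -> : (p.+1 - k - 1 = p - k)%N by lia.
by have -> : (2 * p.+1 - 2 * k - 2 = 2 * (p - k))%N by lia.
Qed.
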